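(* Let $(X,d_X)$ be a metric space, and let $f:\mathcal{W}_{[0,1]}\to L^1([0,1],X)$ be a continuous node-level statistic in $X$; write $f(W,y):=f(W)(y)$. Let $A_1,\dots,A_N\subset X$ be disjoint open sets, and define $$\mathcal{D}:=\Big\{W\in\mathcal{W}_{[0,1]} : f(W,y)\in\bigcup_{j=1}^N A_j \text{ for a.e. } y\in[0,1]\Big\}.$$ Let $S=\{1,\dots,N\}$ and for $W\in\mathcal{D}$ let $c_W:[0,1]\to S$ be the coloring defined for almost every $y$ by letting $c_W(y)=j$, where $j$ is the unique color in $S$ such that $f(W,y)\in A_j$. Then the map $F:(\mathcal{D},\|\cdot\|_\Box)\to(\mathcal{W}_S,\|\cdot\|_\Box^S)$ given by $F(W)=(W,c_W)$ is continuous.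
   Context: A graphon is a symmetric measurable function $W:[0,1]^2\to[0,1]$; $\mathcal{W}_{[0,1]}$ is the set of graphons. $\mu_L$ is Lebesgue measure. The cut-norm of a symmetric measurable function $U$ on $[0,1]^2$ is $\|U\|_\Box:=\sup_{A,B\subset[0,1]}\left|\int_{A\times B}U(x,y)\,dx\,dy\right|$, the supremum over Lebesgue measurable sets $A,B$; $(\mathcal{D},\|\cdot\|_\Box)$ carries the pseudometric $\|W-W'\|_\Box$. For a finite set $S$, an $S$-colored graphon is a pair $(f_W,c_W)$ of measurable maps with $f_W:[0,1]^2\to[0,1]$ symmetric and $c_W:[0,1]\to S$; $\mathcal{W}_S$ is the set of these. For $W=(f_W,c_W)$, $W'=(f_{W'},c_{W'})$ in $\mathcal{W}_S$, put $$\|W-W'\|_\Box^S:=\|f_W-f_{W'}\|_\Box+\sum_{s\in S}\mu_L\big(c_W^{-1}(s)\,\Delta\,c_{W'}^{-1}(s)\big).$$ (This is a pseudometric on $\mathcal{W}_S$; colors on a null set are irrelevant.) $L^1([0,1],X)$ is the set of measurable $g:[0,1]\to X$ (Borel $\sigma$-algebra on $X$), identified when a.e. equal, such that $\int_0^1 d_X(x_0,g(y))\,dy<\infty$ for a point $x_0\in X$, with metric $d_1(g,g')=\int_0^1 d_X(g(y),g'(y))\,dy$. A continuous node-level statistic in $X$ is a function $f:\mathcal{W}_{[0,1]}\to L^1([0,1],X)$ that is continuous from the cut-norm pseudometric to $d_1$. *)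

(* Defs.v *)
From HB Require Import structures.
From mathcomp Require Import all_boot all_order all_algebra.
From mathcomp Require Import all_classical all_reals all_analysis.
Import Order.TTheory GRing.Theory Num.Theory.
Import numFieldNormedType.Exports.

Set Implicit Arguments.
Unset Strict Implicit.
Unset Printing Implicit Defensive.

Local Open Scope classical_set_scope.
Local Open Scope ring_scope.

(* The Lebesgue sigma-algebras on R and on R * R are the Caratheodory (that is,
   completed) ones; the library's default sigma-algebra on R is the Borel one. *)
Notation LebR R := (caratheodory_type ((@wlength R idfun)^*)%mu).
Notation leb R := (@completed_lebesgue_measure R).

Notation borel_lebesgue2 R :=
  ((@lebesgue_measure R) \x (@lebesgue_measure R))%E.
Notation LebR2 R := (caratheodory_type ((borel_lebesgue2 R)^*)%mu).
Notation leb2 R := (@completed_measure_extension _ _ _ (borel_lebesgue2 R)).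

Definition I01 (R : realType) : set (LebR R) := `[0, 1].
Arguments I01 R : clear implicits.

(* The ascription matters: as a mere [I01 R `*` I01 R] it would live in the
   product sigma-algebra, which is not complete. *)
Definition I01sq (R : realType) : set (LebR2 R) := I01 R `*` I01 R.
Arguments I01sq R : clear implicits.

(* Functions on [0,1] and [0,1]^2 are represented by functions on R and R * R;
   only their values on [0,1] and [0,1]^2 matter. *)
Record graphon (R : realType) := Graphon {
  graphon_fun :> LebR2 R -> R ;
  graphon_measurable : measurable_fun (I01sq R) graphon_fun ;
  graphon_itv : forall x y, I01 R x -> I01 R y -> 0 <= graphon_fun (x, y) <= 1 ;
  graphon_sym : forall x y, I01 R x -> I01 R y ->
    graphon_fun (x, y) = graphon_fun (y, x) }.

Definition cut_norm (R : realType) (U : LebR2 R -> R) : \bar R :=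
  ereal_sup [set r | exists A B : set (LebR R),
    [/\ measurable A, A `<=` I01 R, measurable B, B `<=` I01 R &
        r = `| \int[leb2 R]_(z in A `*` B) (U z)%:E |%E]].

Definition cut_dist (R : realType) (W W' : graphon R) : \bar R :=
  cut_norm (fun z => W z - W' z).

Record coloring (R : realType) (S : finType) := Coloring {
  coloring_fun :> LebR R -> S ;
  coloring_measurable : forall B : set S,
    measurable (I01 R `&` coloring_fun @^-1` B) }.

Definition colored_graphon (R : realType) (S : finType) : Type :=
  (graphon R * coloring R S)%type.

Definition colored_cut_dist (R : realType) (S : finType)
    (W W' : colored_graphon R S) : \bar R :=
  (cut_dist W.1 W'.1 +
   \sum_(s : S) leb R ((I01 R `&` W.2 @^-1` [set s]) `+`
                       (I01 R `&` W'.2 @^-1` [set s])))%E.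

Section L1.
Context (R : realType) (X : metricType R).

(* Measurability for the Borel sigma-algebra [<<s open >>] of X is spelled out
   because the library only turns pointed types into measurable types. *)
Record L1fun := L1Fun {
  L1fun_fun :> LebR R -> X ;
  L1fun_measurable : forall B : set X, <<s open >> B ->
    measurable (I01 R `&` L1fun_fun @^-1` B) ;
  L1fun_integrable : exists x0 : X,
    (\int[leb R]_(y in I01 R) (mdist x0 (L1fun_fun y))%:E < +oo)%E }.

HB.instance Definition _ := gen_eqMixin L1fun.
HB.instance Definition _ := gen_choiceMixin L1fun.

Definition L1_eq (g h : L1fun) : bool := `[< g = h %[ae leb R in I01 R] >].

Let L1_eq_refl : reflexive L1_eq.
Proof. by move=> g; apply/asboolP; exact: ae_eq_refl. Qed.

Let L1_eq_sym : symmetric L1_eq.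
Proof. by move=> g h; apply/idP/idP => /asboolP gh; apply/asboolP/ae_eq_sym. Qed.

Let L1_eq_trans : transitive L1_eq.
Proof.
by move=> g h k /asboolP hg /asboolP gk; apply/asboolP/(ae_eq_trans hg gk).
Qed.

Canonical L1_eq_canonical := EquivRel L1_eq L1_eq_refl L1_eq_sym L1_eq_trans.

Local Open Scope quotient_scope.

Definition L1 : Type := {eq_quot L1_eq}.
HB.instance Definition _ := Choice.on L1.
HB.instance Definition _ := EqQuotient.on L1.

(* A class is applied to a point through its canonical representative. *)
Definition L1_to_fun (g : L1) : LebR R -> X := repr g.
Coercion L1_to_fun : L1 >-> Funclass.

(* If X is not separable, [mdist (g y) (h y)] need not be measurable in y; the
   library integral of a nonnegative function is then its lower integral. *)
Definition L1_dist (g h : L1) : \bar R :=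
  (\int[leb R]_(y in I01 R) (mdist (g y) (h y))%:E)%E.

End L1.

Definition dist_continuous (R : realType) (T U : Type)
    (dT : T -> T -> \bar R) (dU : U -> U -> \bar R) (f : T -> U) : Prop :=
  forall (x : T) (e : R), 0 < e ->
  exists2 d : R, 0 < d &
    forall x' : T, (dT x x' < d%:E)%E -> (dU (f x) (f x') < e%:E)%E.

Definition node_statistic_continuous (R : realType) (X : metricType R)
    (f : graphon R -> L1 X) : Prop :=
  dist_continuous (@cut_dist R) (@L1_dist R X) f.

Section induced_coloring.
Context (R : realType) (X : metricType R) (N : nat).
Variables (f : graphon R -> L1 X) (A : 'I_N -> set X).

Definition ae_covered : set (graphon R) :=
  [set W | {ae leb R, forall y, I01 R y -> (\bigcup_j A j) (f W y)}].

(* c W is the coloring c_W of the graphon W, which is only determined up to a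
   null set; the colors 1, ..., N are the elements of 'I_N. *)
Definition is_induced_coloring (c : ae_covered -> coloring R 'I_N) : Prop :=
  forall W : ae_covered,
    {ae leb R, forall y, I01 R y -> A (c W y) (f (\val W) y)}.

Definition attach_coloring (c : ae_covered -> coloring R 'I_N)
  (W : ae_covered) : colored_graphon R 'I_N := (\val W, c W).

End induced_coloring.

(* Main.v *)
(** The points at distance at least [r] from the complement of an open set [U]
    form a closed set [core r U], and these sets exhaust [U] as [r] tends to 0.
    Hence, for fixed [W] and small [r], [f(W, y)] lies in some [core r (A j)]
    except for [y] in a set of small measure. If [y] is outside this set and
    [c_W(y) <> c_W'(y)], then [f(W, y)] and [f(W', y)] are at distance at least
    [r], so by Markov's inequality the measure of these [y] is at most
    [d_1(f(W), f(W')) / r], which the continuity of [f] makes small. *)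

Require Import Defs.
From mathcomp Require Import all_boot all_order all_algebra.
From mathcomp Require Import all_classical all_reals all_analysis.
Import Order.TTheory GRing.Theory Num.Theory.
Import numFieldNormedType.Exports.

Set Implicit Arguments.
Unset Strict Implicit.
Unset Printing Implicit Defensive.

Local Open Scope classical_set_scope.
Local Open Scope ring_scope.

Lemma setI_preimageC (T U : Type) (D : set T) (f : T -> U) (B : set U) :
  D `&` f @^-1` (~` B) = D `\` (D `&` f @^-1` B).
Proof. by rewrite preimage_setC setDIr setDv set0U setDE. Qed.

Section lower_integral.
Context d (T : measurableType d) (R : realType).
Variable mu : {measure set T -> \bar R}.
Local Open Scope ereal_scope.

(* Unlike [ge0_le_integral], this requires no measurability: the integral of a
   nonnegative function is the supremum over the simple functions below it. *)
Lemma ge0_le_lower_integral (D : set T) (f g : T -> \bar R) :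
  (forall x, D x -> 0 <= f x) -> (forall x, D x -> f x <= g x) ->
  \int[mu]_(x in D) f x <= \int[mu]_(x in D) g x.
Proof.
move=> f0 fg; have g0 x : D x -> 0 <= g x.
  by move=> Dx; exact: le_trans (f0 x Dx) (fg x Dx).
rewrite !ge0_integralE//; apply: le_ereal_sup => _ [h /= hf <-].
by exists h => //= x; exact: le_trans (hf x) (lee_restrict fg x).
Qed.

(** The function equal to [r] on [M] and to 0 elsewhere lies below [f] on [D]. Here [f] may be
    nonmeasurable, as the distance between two functions into a nonseparable space can be. *)
Lemma lower_integral_markov (D M : set T) (f : T -> \bar R) (r : R) :
  measurable M -> M `<=` D -> (0 <= r)%R -> (forall x, D x -> 0 <= f x) ->
  (forall x, M x -> r%:E <= f x) ->
  r%:E * mu M <= \int[mu]_(x in D) f x.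
Proof.
move=> mM MD r0 f0 rf; rewrite -integral_cst// -(setIidr MD) integral_mkcondr.
apply: ge0_le_lower_integral => x Dx; rewrite /patch; case: ifPn => //.
- by rewrite inE => /rf.
- by move=> _; exact: f0.
Qed.

End lower_integral.

Section core.
Context (R : realType) (X : metricType R).

(** Bounding every distance instead of their infimum makes the core of the whole space the whole
    space. *)
Definition core (r : R) (A : set X) : set X :=
  [set x | forall y, ~ A y -> r <= mdist x y].

Lemma closed_core r A : closed (core r A).
Proof.
rewrite -openC openE => x /existsNP[y /not_implyP[nAy /negP]].
rewrite -ltNge => xyr; apply/nbhs_ballP.
exists (r - mdist x y) => /=; first by rewrite subr_gt0.
move=> z; rewrite ballEmdist /= => xz /(_ _ nAy); apply/negP; rewrite -ltNge.
by rewrite (le_lt_trans (metric_triangle z x y))// metric_sym -ltrBrDr.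
Qed.

Lemma core_sub r A : 0 < r -> core r A `<=` A.
Proof.
move=> r0 x Ax; apply: contrapT => /Ax; apply/negP.
by rewrite -ltNge mdistxx.
Qed.

Lemma le_core r s A : r <= s -> core s A `<=` core r A.
Proof. by move=> rs x Ax y /Ax; exact: le_trans. Qed.

Lemma open_core A x : open A -> A x -> exists n, core n.+1%:R^-1 A x.
Proof.
rewrite openE => /[apply] /nbhs_ballP[e /= e0 xeA].
have [n _ /(_ n (leqnn n)) ne] := near_infty_natSinv_lt (PosNum e0).
exists n => y; apply: contra_notT; rewrite -ltNge => xy; apply: xeA.
by rewrite ballEmdist /=; exact: lt_trans ne.
Qed.

End core.

Section colorings.
Context (R : realType) (X : metricType R) (N : nat) (A : 'I_N -> set X).
Hypothesis openA : forall j, open (A j).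
Hypothesis trivA : trivIset [set: 'I_N] A.

Lemma measurable_I01 : measurable (I01 R).
Proof.
by apply: sub_caratheodory; exact: (measurable_itv `[0, 1]).
Qed.

Lemma lebesgue_I01 : leb R (I01 R) = 1%E.
Proof.
transitivity (lebesgue_measure (`[0, 1]%classic : set R)) => //.
by rewrite lebesgue_measure_itv /= lte_fin ltr01 oppr0 adde0.
Qed.

Lemma measurable_L1fun_open (g : L1fun X) B :
  open B -> measurable (I01 R `&` g @^-1` B).
Proof. by move=> oB; apply: L1fun_measurable; exact: sub_sigma_algebra. Qed.

Lemma measurable_L1fun_closed (g : L1fun X) B :
  closed B -> measurable (I01 R `&` g @^-1` B).
Proof.
move=> cB; rewrite -[B]setCK setI_preimageC.
apply: measurableD; first exact: measurable_I01.
by apply: measurable_L1fun_open; rewrite openC.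
Qed.

Definition off_core (g : L1fun X) (r : R) : set (LebR R) :=
  I01 R `\` \bigcup_j (I01 R `&` g @^-1` core r (A j)).

(** Phrased by values instead of colors, so that [g] and [h] are at least [r] apart at every point
    of it and null sets stay out of the Markov estimate. *)
Definition crossing (g h : L1fun X) (r : R) : set (LebR R) :=
  \bigcup_j \bigcup_(k in [set k | k != j])
    ((I01 R `&` g @^-1` core r (A j)) `&` (I01 R `&` h @^-1` A k)).

Lemma measurable_off_core g r : measurable (off_core g r).
Proof.
apply: measurableD; first exact: measurable_I01.
apply: fin_bigcup_measurable => [|j _]; first exact: finite_finset.
by apply: measurable_L1fun_closed; exact: closed_core.
Qed.

Lemma measurable_crossing g h r : measurable (crossing g h r).
Proof.
apply: fin_bigcup_measurable => [|j _]; first exact: finite_finset.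
  apply: fin_bigcup_measurable => [|k _]; first exact: finite_finset.
apply: measurableI; last exact: measurable_L1fun_open.
by apply: measurable_L1fun_closed; exact: closed_core.
Qed.

(** Continuity from above along [r = 1/(n+1)], inside [I01] of measure 1: a covered value lies in
    some open [A j], hence in its core for large [n], so the intersection is null. *)
Lemma off_core_small (g : L1fun X) (e : R) : 0 < e ->
  {ae leb R, forall y, I01 R y -> (\bigcup_j A j) (g y)} ->
  exists2 r : R, 0 < r & (leb R (off_core g r) < e%:E)%E.
Proof.
move=> e0 gA; pose F n := off_core g n.+1%:R^-1.
have mF n : measurable (F n) by exact: measurable_off_core.
have mcapF : measurable (\bigcap_n F n) by exact: bigcapT_measurable.
have F0 : (leb R (F 0%N) < +oo)%E.
  apply: (@le_lt_trans _ _ (leb R (I01 R))).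
    by apply: le_measure; rewrite ?inE //; [exact: measurable_I01|move=> ? []].
  by rewrite lebesgue_I01 ltry.
have ndF : nonincreasing_seq F.
  move=> m n mn; apply/subsetPset => y [Iy nc]; split => // -[j _ [_ gj]].
  apply: nc; exists j => //; split => //; apply: le_core gj.
  by rewrite lef_pV2 ?posrE// ler_nat ltnS.
have capF0 : leb R (\bigcap_n F n) = 0%E.
  apply/negligibleP => //; apply: negligibleS gA => y Fy /= gy.
  have [Iy _] := Fy 0%N Logic.I; have [j _ Aj] := gy Iy.
  have [n gn] := open_core (openA j) Aj.
  by have [_] := Fy n Logic.I; apply; exists j.
have : \forall n \near \oo, ((leb R \o F) n < e%:E)%E.
  have := @nonincreasing_cvg_mu _ _ _ (leb R) F F0 mF mcapF ndF.
  move=> /(_ [set u | (u < e%:E)%E]); apply; apply: open_ereal_lt'.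
  by apply: (@le_lt_trans _ _ 0%E); [rewrite -capF0|rewrite lte_fin].
case=> n _ /(_ n (leqnn n)) /= Fn; exists n.+1%:R^-1 => //; exact: Fn.
Qed.

(** By disjointness a value of [h] in [A k] is outside [A j], so a value of [g] in the core of [A j]
    is at least [r] away from it. *)
Lemma le_crossing (g h : L1 X) (r : R) : 0 < r ->
  (r%:E * leb R (crossing (repr g) (repr h) r) <= L1_dist g h)%E.
Proof.
move=> r0; apply: lower_integral_markov; rewrite ?ltW//.
- exact: measurable_crossing.
- by move=> y [j _ [k _ [[]]]].
- by move=> y _; rewrite lee_fin mdist_ge0.
move=> y [j _ [k kj [[_ gj] [_ hk]]]]; rewrite lee_fin; apply: gj => hj.
move/eqP: kj; apply; apply: trivA => //.
by exists (h y).
Qed.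

Lemma le_color_class_diff (g h : L1fun X) (c c' : coloring R 'I_N) (r : R) s :
  0 < r ->
  {ae leb R, forall y, I01 R y -> A (c y) (g y)} ->
  {ae leb R, forall y, I01 R y -> A (c' y) (h y)} ->
  (leb R ((I01 R `&` c @^-1` [set s]) `+` (I01 R `&` c' @^-1` [set s])) <=
   leb R (off_core g r) + leb R (crossing g h r))%E.
Proof.
move=> r0 [Z [mZ Z0 cZ]] [Z' [mZ' Z'0 cZ']].
have mG := measurable_off_core g r; have mM := measurable_crossing g h r.
have ZZ'0 : (leb R (Z `|` Z') <= 0)%E.
  suff -> : leb R (Z `|` Z') = 0%E by [].
  apply/negligibleP; first exact: measurableU.
  by apply: negligibleU; apply/negligibleP.
(* [Z] and [Z'] absorb the points whose color does not name the set containing the value. *)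
apply: (@le_trans _ _
    (leb R ((off_core g r `|` crossing g h r) `|` (Z `|` Z')))).
  apply: le_measure; rewrite ?inE.
  - by apply: measurableU; apply: measurableD; exact: coloring_measurable.
  - by do 2 apply: measurableU => //; exact: measurableU.
  move=> y ydiff; have [ZZ'y|/not_orP[nZ nZ']] := pselect ((Z `|` Z') y).
    by right.
  left; have [Iy cc'] : I01 R y /\ c y != c' y.
    case: ydiff => -[[Iy /= cs] nc's]; split => //; apply/eqP => cc'; apply: nc's;
      split => //=; congruence.
  have gA : A (c y) (g y).
    by apply: contrapT => nA; apply: nZ; apply: cZ => /(_ Iy).
  have hA : A (c' y) (h y).
    by apply: contrapT => nA; apply: nZ'; apply: cZ' => /(_ Iy).
  have [[j _ [_ gj]]|nc] :=
    pselect ((\bigcup_j (I01 R `&` g @^-1` core r (A j))) y); last by left.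
  (* As [g y] lies in both [A j] and [A (c y)], disjointness forces [j = c y], which differs from
     [c' y]. *)
  right; exists j => //; exists (c' y) => //=.
  rewrite (@trivA j (c y)) // 1?eq_sym //; exists (g y); split => //.
  exact: core_sub gj.
rewrite -[leRHS]adde0.
apply: (le_trans (measureU2 _ _ _)); [exact: measurableU|exact: measurableU|].
by apply: leeD; [exact: measureU2|exact: ZZ'0].
Qed.

Lemma exists_coloring (g : L1fun X) :
  {ae leb R, forall y, I01 R y -> (\bigcup_j A j) (g y)} ->
  exists c : coloring R 'I_N, {ae leb R, forall y, I01 R y -> A (c y) (g y)}.
Proof.
move=> gA.
(* If [N] were 0, covering would force [0, 1] to be null. *)
have [j0 _] : exists j0 : 'I_N, True.
  apply: contrapT => noj; have : leb R (I01 R) = 0%E.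
    apply/negligibleP; first exact: measurable_I01.
    by apply: negligibleS gA => y Iy /= /(_ Iy) [j _ _]; apply: noj; exists j.
  by rewrite lebesgue_I01 => /eqP; rewrite onee_eq0.
pose c y := xget j0 [set j | A j (g y)].
have cA y : (\bigcup_j A j) (g y) -> A (c y) (g y).
  by case=> j _ Aj; apply: (@xgetPex _ j0 [set k | A k (g y)]); exists j.
(* Points whose value is in no [A j] have color [j0], so they stay out of the preimage of [B]. *)
have mc (B : set 'I_N) : ~ B j0 -> measurable (I01 R `&` c @^-1` B).
  move=> Bj0; have -> : I01 R `&` c @^-1` B =
      \bigcup_(s in B) (I01 R `&` g @^-1` A s).
    apply/seteqP; split => y /=.
      move=> [Iy Bc]; exists (c y) => //; split => //.
      rewrite /c; case: xgetP => [j -> //|nA].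
      by move: Bc; rewrite /c; case: xgetP => // j _ /nA.
    move=> [s Bs [Iy As]]; split => //; suff -> : c y = s by [].
    apply: trivA => //; exists (g y); split => //.
    by apply: cA; exists s.
  apply: fin_bigcup_measurable => [|j _]; first exact: finite_finset.
  exact: measurable_L1fun_open.
(* Off the covered points [c] takes the junk value [j0], so a class containing
   [j0] is measured through its complement. *)
have {}mc (B : set 'I_N) : measurable (I01 R `&` c @^-1` B).
  have [Bj0|/mc//] := pselect (B j0).
  rewrite -[B]setCK setI_preimageC.
  apply: measurableD; first exact: measurable_I01.
  by apply: mc => /=.
exists (Coloring mc); apply: filterS gA => y + Iy.
by move=> /(_ Iy); exact: cA.
Qed.

End colorings.

Theorem theorem1 (R : realType) (X : metricType R) (f : graphon R -> L1 X)
    (hf : node_statistic_continuous f)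
    (N : nat) (A : 'I_N -> set X)
    (hopen : forall j, open (A j)) (hdisj : trivIset [set: 'I_N] A) :
  (exists c : ae_covered f A -> coloring R 'I_N, is_induced_coloring c) /\
  (forall c : ae_covered f A -> coloring R 'I_N, is_induced_coloring c ->
    dist_continuous
      (fun W W' : ae_covered f A => cut_dist (\val W) (\val W'))
      (@colored_cut_dist R 'I_N)
      (attach_coloring c)).
Proof.
split.
  have /choice[c cA] (W : ae_covered f A) : exists c : coloring R 'I_N,
      {ae leb R, forall y, I01 R y -> A (c y) (f (\val W) y)}.
    by apply: exists_coloring => //; exact: set_valP W.
  by exists c.
move=> c cA W e e0.
(* Each of the [N] colors will cost at most [2 * eta], in total at most [e / 2]; [N.+1] avoids
   dividing by 0 when [N] is 0. *)
pose eta := e / 2 / N.+1%:R / 2.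
have eta0 : 0 < eta by rewrite !divr_gt0.
(* Only the values of [f W] are tested against cores, so [r], and then [d], depend on [W] and not on
   [W']. *)
have [r r0 Gr] := off_core_small hopen eta0 (set_valP W).
have [d d0 hd] := hf (\val W) (r * eta) (mulr_gt0 r0 eta0).
(* [d] controls the colors, [e / 2] the cut distance; the latter bound is strict, so a weak one
   suffices for the colors. *)
exists (Num.min d (e / 2)); first by rewrite lt_min d0 divr_gt0.
move=> W' WW'; rewrite /colored_cut_dist /= [e]splitr EFinD.
have [Wd We] : (cut_dist (\val W) (\val W') < d%:E)%E /\
    (cut_dist (\val W) (\val W') < (e / 2)%:E)%E.
  by split; apply: (lt_le_trans WW'); rewrite lee_fin ge_min lexx ?orbT.
apply: (@le_lt_trans _ _ (cut_dist (\val W) (\val W') + (e / 2)%:E)%E);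
  last by rewrite lteD2rE.
apply: leeD2l.
have Mr : (leb R (crossing A (repr (f (\val W))) (repr (f (\val W'))) r) <
    eta%:E)%E.
  rewrite -(@lte_pmul2l _ r%:E)// -EFinM.
  apply: le_lt_trans (le_crossing hopen hdisj _ _ r0) _.
  exact: hd.
apply: (@le_trans _ _ (\sum_(s < N) (eta + eta)%:E)%E).
  apply: lee_sum => s _.
  apply: le_trans (le_color_class_diff hopen hdisj s r0 (cA W) (cA W')) _.
  by rewrite EFinD leeD// ltW.
rewrite sumEFin lee_fin sumr_const card_ord -splitr -[leLHS]mulr_natr mulrAC.
by rewrite ler_pdivrMr// ler_pM2l ?divr_gt0// ler_nat.
Qed.
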